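(* Let $\psi_a=\mu(\phi_p,\delta_q)y$, $\mu\in R[\xi_p,\xi_q]$, be a non-degenerate $\{\delta_p,\delta_q\}$-character of $\mathbb{G}_a$ over $R$, with characteristic integers $\mathcal K$, $\mathcal K_{\pm}$ the subsets of positive (resp. negative) characteristic integers, $\rho_{\pm}=\#\mathcal K_{\pm}$, and $\mathcal U_{\pm1}=\{u\in q^{\pm1}R[[q^{\pm1}]]:\psi_au=0\}$. For $u=\sum a_nq^n$ put $B^0_\kappa u=a_\kappa$ and $B^0_{\pm}u=(a_\kappa)_{\kappa\in\mathcal K_\pm}$. Then the maps $B^0_{\pm}:\mathcal U_{\pm1}\to R^{\rho_\pm}$ are isomorphisms of $R$-modules ($\mathcal U_{\pm 1}$ being an $R$-module under convolution $\star$). Furthermore, for any $u\in\mathcal U_{\pm1}$, $$u=\sum_{\kappa\in\mathcal K_{\pm}}(B^0_\kappa u)\star u_{a,\kappa,1}.$$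
   Context: $p\ne 2$ is a prime, $R$ is the completion of the maximal unramified extension of $\mathbb Z_p$, $\phi:R\to R$ the unique automorphism lifting the $p$-power Frobenius on $k=R/pR$, $\mu(R)$ the group of roots of unity of $R$. On $R[[q^{\pm1}]]$, $\phi_p(\sum a_nq^n)=\sum\phi(a_n)q^{pn}$ and $\delta_q(\sum a_nq^n)=\sum na_nq^n$. For $\mu(\xi_p,\xi_q)=\sum\mu_{ij}\xi_p^i\xi_q^j\in R[\xi_p,\xi_q]$, the character $\psi_a=\mu(\phi_p,\delta_q)y$ acts by $\psi_a u=\sum\mu_{ij}\phi_p^i\delta_q^ju$. It is non-degenerate if $\mu(0,0)\in R^\times$. A characteristic integer is $\kappa\in\mathbb Z$ with $\mu(0,\kappa)=0$ (such $\kappa$ is then prime to $p$). Basic series: for $0\ne\kappa\in\mathbb Z$, $\alpha\in R$, $u_{a,\kappa,\alpha}=\sum_{n\ge0}b_{n,\kappa}\,\phi^n(\alpha)\,q^{\kappa p^n}$, where $b_{0,\kappa}=1$ and, for $n\ge1$, $$b_{n,\kappa}=-\frac{\sum_{s=1}^n\big(\sum_{j\ge0}\mu_{sj}\kappa^jp^{j(n-s)}\big)\phi^s(b_{n-s,\kappa})}{\sum_{j\ge0}\mu_{0j}\kappa^jp^{jn}}\in R.$$ Convolution: $\mathcal U_{\pm1}$ is the internal direct sum over $\kappa\in\mathcal K_\pm$ of the groups $\{u_{a,\kappa,\alpha}:\alpha\in R\}$. The $p$-adic completion $\mathbb Z\mu(R)\hat{\ }$ of the group ring of $\mu(R)$ acts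 on $q^{\pm1}R[[q^{\pm1}]]$ by $(f\star u)(q)=\sum_\zeta f(\zeta)u(\zeta q)$. For $\kappa$ prime to $p$, on $\{u_{a,\kappa,\alpha}:\alpha\in R\}$ this action factors through the surjective ring homomorphism $\mathbb Z\mu(R)\hat{\ }\to R$, $f\mapsto\sum_\zeta f(\zeta)\zeta^\kappa$, giving an $R$-module structure $\star$, explicitly $\beta\star u_{a,\kappa,\alpha}=u_{a,\kappa,\beta\alpha}$. The $R$-module structure on $\mathcal U_{\pm1}$ is the direct sum of these. *)

(* Defs.v *)
From HB Require Import structures.
From mathcomp Require Import all_boot all_order all_algebra finmap.
From mathcomp Require Import boolp classical_sets functions cardinality.

Set Implicit Arguments.
Unset Strict Implicit.
Unset Printing Implicit Defensive.

Import Order.TTheory GRing.Theory Num.Theory.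
Local Open Scope classical_set_scope.
Local Open Scope ring_scope.

Section Padic.
Variable p : nat.

(* x is in p^N A *)
Definition pdvd (A : comNzRingType) (N : nat) (x : A) : Prop :=
  exists y, x = p%:R ^+ N * y.

Definition padic_lim (A : comNzRingType) (u : nat -> A) (l : A) : Prop :=
  forall N, exists n0, forall n, (n0 <= n)%N -> pdvd N (u n - l).

Definition padic_cauchy (A : comNzRingType) (u : nat -> A) : Prop :=
  forall N, exists n0, forall m n, (n0 <= m)%N -> (n0 <= n)%N ->
    pdvd N (u m - u n).

(* The last two fields say that A / p^N -> B / p^N is bijective for all N,
   so that B is the inverse limit of the A / p^N. *)
Record padic_completion (A B : comNzRingType) (j : A -> B) : Prop := {
  pc_separated : forall x : B, (forall N, pdvd N x) -> x = 0;
  pc_complete  : forall u : nat -> B, padic_cauchy u -> exists l, padic_lim u l;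
  pc_dense     : forall N (b : B), exists a, pdvd N (b - j a);
  pc_exact     : forall N (a : A), pdvd N (j a) -> pdvd N a
}.

(* A is an integral extension of Z_p, local with maximal ideal pA (that is,
   unramified; residue extensions are separable since F_p is perfect), and it
   is maximal as such: its residue field A / pA has no proper algebraic
   extension. *)
Record max_unramified (Zp A : idomainType) (i : Zp -> A) : Prop := {
  unr_inj      : injective i;
  unr_integral : integralRange i;
  unr_local    : forall x : A, x \is a GRing.unit <-> ~ pdvd 1 x;
  unr_maximal  : forall P : {poly A}, P \is monic -> (1 < size P)%N ->
                  exists x, pdvd 1 P.[x]
}.

Definition completed_max_unramified (R : idomainType) : Prop :=
  exists (Zp A : idomainType) (i : {rmorphism Zp -> A}) (j : {rmorphism A -> R}),
    [/\ padic_completion (fun n : int => n%:~R : Zp),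
        max_unramified i
      & padic_completion j].

Definition frobenius_lift (R : comNzRingType) (phi : R -> R) : Prop :=
  bijective phi /\ forall x, pdvd 1 (phi x - x ^+ p).

(* Unconditional p-adic summation of a family indexed by R itself. *)
Definition padic_sum (R : idomainType) (g : R -> R) (s : R) : Prop :=
  forall N, exists F : {fset R}, forall G : {fset R}, (F `<=` G)%fset ->
    pdvd N (s - \sum_(z <- G) g z).

Definition psum (R : idomainType) (g : R -> R) : R :=
  xget 0 [set s | padic_sum g s].

Definition mu_roots (R : idomainType) : set R :=
  [set z | exists2 n, (0 < n)%N & z ^+ n = 1].

(* The image of Z_p in R: the closure of Z. *)
Definition in_Zp (R : idomainType) : set R :=
  [set x | forall N, exists m : int, pdvd N (x - m%:~R)].

(* The p-adic completion of the group ring of mu(R): families of p-adic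
   integers indexed by mu(R) and tending to 0, extended by 0 to R. *)
Definition completed_group_ring (R : idomainType) : set (R -> R) :=
  [set f | [/\ forall z, ~ mu_roots z -> f z = 0,
               forall z, in_Zp (f z)
             & forall N, finite_set [set z | ~ pdvd N (f z)]]].

End Padic.

Section Characters.
Variables (p : nat) (R : idomainType) (phi : R -> R).

(* A formal series \sum_n a_n q^n, n in Z, is the function n |-> a_n. *)
Definition phi_p (u : int -> R) : int -> R :=
  fun n => if (p %| n)%Z then phi (u (n %/ p)%Z) else 0.

Definition delta_q (u : int -> R) : int -> R := fun n => n%:~R * u n.

(* In {poly {poly R}} the outer variable is xi_p and the inner one xi_q, so
   that mu_ij is mu`_i`_j. *)
Variable mu : {poly {poly R}}.

Definition psi_a (u : int -> R) : int -> R :=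
  fun n => \sum_(i < size mu) \sum_(j < size mu`_i)
    mu`_i`_j * iter i phi_p (iter j delta_q u) n.

Definition nondegenerate_char : Prop := mu.[0].[0] \is a GRing.unit.

Definition char_int : set int := [set k | mu.[0].[k%:~R] = 0].

(* The sign is + for s = true and - for s = false. *)
Definition on_side (s : bool) (n : int) : bool := if s then 0 < n else n < 0.

(* See finite_char_int below for the finiteness that fset_set presupposes. *)
Definition K_ (s : bool) : {fset int} :=
  fset_set [set k | char_int k /\ on_side s k].

Definition rho (s : bool) : nat := #|` K_ s|%fset.

Definition series (s : bool) : set (int -> R) :=
  [set u | forall n, ~~ on_side s n -> u n = 0].

Definition U_ (s : bool) : set (int -> R) :=
  [set u | series s u /\ psi_a u = 0].

(* [:: b_0; ...; b_n]; see bE0 and bES for the recursion. *)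
Fixpoint b_upto (k : int) (n : nat) : seq R :=
  if n is m.+1 then
    let bs := b_upto k m in
    rcons bs (- (\sum_(1 <= t < n.+1)
                   (mu`_t).[(k * (p ^ (n - t))%N%:Z)%:~R] * iter t phi bs`_(n - t))
              / (mu`_0).[(k * (p ^ n)%N%:Z)%:~R])
  else [:: 1].

Definition b (k : int) (n : nat) : R := (b_upto k n)`_n.

(* The exponents k p^n are distinct for k != 0, and m = k p^n forces n <= |m|. *)
Definition basic (k : int) (alpha : R) : int -> R :=
  fun m => \sum_(n < `|m|%N.+1 | m == k * (p ^ n)%N%:Z)
             b k n * iter n phi alpha.

Definition conv (f : R -> R) (u : int -> R) : int -> R :=
  fun n => psum p (fun z => f z * z ^ n * u n).

Definition ev_char (k : int) (f : R -> R) : R := psum p (fun z => f z * z ^ k).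

(* beta acts on the summand indexed by k through any f k in the completed
   group ring that ev_char k maps to beta. For u in U_ s, v depends neither on
   this choice of f nor on alpha, so that star is then the module structure. *)
Definition star_rel (s : bool) (beta : R) (u v : int -> R) : Prop :=
  exists (alpha : int -> R) (f : int -> R -> R),
    [/\ forall k, k \in K_ s ->
          completed_group_ring p (f k) /\ ev_char k (f k) = beta,
        u = \sum_(k <- K_ s) basic k (alpha k)
      & v = \sum_(k <- K_ s) conv (f k) (basic k (alpha k))].

Definition star (s : bool) (beta : R) (u : int -> R) : int -> R :=
  xget 0 [set v | star_rel s beta u v].

Definition B0 (k : int) (u : int -> R) : R := u k.

Definition B0s (s : bool) (u : int -> R) : 'rV[R]_(rho s) :=
  \row_(i < rho s) B0 (nth 0 (K_ s) i) u.

End Characters.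

Record module_on (R : nzRingType) (V : zmodType) (U : set V)
    (act : R -> V -> V) : Prop := {
  mo_zero  : U 0;
  mo_sub   : forall u v, U u -> U v -> U (u - v);
  mo_act   : forall a u, U u -> U (act a u);
  mo_assoc : forall a c u, U u -> act a (act c u) = act (a * c) u;
  mo_one   : forall u, U u -> act 1 u = u;
  mo_addr  : forall a u v, U u -> U v -> act a (u + v) = act a u + act a v;
  mo_addl  : forall a c u, U u -> act (a + c) u = act a u + act c u
}.

Record module_iso_on (R : nzRingType) (V : zmodType) (W : lmodType R)
    (U : set V) (act : R -> V -> V) (g : V -> W) : Prop := {
  mi_add : forall u v, U u -> U v -> g (u + v) = g u + g v;
  mi_act : forall a u, U u -> g (act a u) = a *: g u;
  mi_bij : set_bij U [set: W] g
}.

Section Facts.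
Variables (p : nat) (R : idomainType).

Lemma int_inj_completed : prime p -> completed_max_unramified p R ->
  injective (fun n : int => n%:~R : R).
Proof.
move=> pp [Zp [A [i [j [cZ mA cR]]]]].
have pZ0 : (p%:R : Zp) != 0.
  apply/eqP => p0.
  have [y] : pdvd p 2 (p%:Z).
    by apply: (pc_exact cZ); exists 0; rewrite mulr0.
  move/(congr1 absz); rewrite abszM abszX natz /= => e.
  have : (p ^ 2 %| p ^ 1)%N by rewrite expn1 {2}e dvdn_mulr.
  by rewrite dvdn_Pexp2l // prime_gt1.
have kerA a : j a = 0 -> forall N, pdvd p N a.
  by move=> ja N; apply: (pc_exact cR); rewrite ja; exists 0; rewrite mulr0.
have pA0 : (p%:R : A) != 0.
  by rewrite -(rmorph_nat i) -(rmorph0 i) (inj_eq (unr_inj mA)).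
have pA1 : ~ (p%:R : A) \is a GRing.unit.
  by move/(unr_local mA); apply; exists 1; rewrite expr1 mulr1.
have pR0 : (p%:R : R) != 0.
  apply/eqP => p0; have [|y] := @kerA p%:R _ 2; first by rewrite rmorph_nat.
  rewrite expr2 -mulrA -[X in X = _]mulr1 => /(mulfI pA0) e.
  by apply: pA1; apply/unitrP; exists y; rewrite mulrC -e.
have pR1 : ~ (p%:R : R) \is a GRing.unit.
  move=> u; have [|y e] := @pc_exact p A R j cR 1 1.
    by exists (p%:R^-1); rewrite rmorph1 expr1 divrr.
  by apply: pA1; apply/unitrP; exists y; rewrite mulrC -[p%:R]expr1 -e.
have natR0 n : (0 < n)%N -> (n%:R : R) != 0.
  move=> n0; apply/eqP => e.
  have pch : forall q, prime q -> (q%:R : R) = 0 -> q = p.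
    move=> q pq q0; apply/eqP/negPn/negP => qp.
    have cq : coprime p q by rewrite prime_coprime // dvdn_prime2 // eq_sym.
    have [[a c] /= E] : exists ac : nat * nat, (p * ac.1 = q * ac.2 + 1)%N.
      have [a c E _] := egcdnP q (prime_gt0 pp).
      exists (a, c); rewrite mulnC E (eqP (_ : coprime p q)) //.
      by rewrite mulnC.
    apply: pR1; apply/unitrP; exists a%:R; rewrite mulrC -natrM E natrD natrM q0.
    by rewrite mul0r add0r.
  have : forall m, (0 < m)%N -> (m%:R : R) != 0; last by move/(_ n n0); rewrite e eqxx.
  elim/ltn_ind => m IH m0; have [m1|m1] := leqP m 1.
    by rewrite (_ : m = 1%N) ?oner_eq0 //; apply/eqP; rewrite eqn_leq m1.
  rewrite -(divnK (pdiv_dvd m)) natrM mulf_neq0 //.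
    apply: IH; first by rewrite ltn_Pdiv // prime_gt1 // pdiv_prime.
    by rewrite divn_gt0 ?pdiv_gt0 // dvdn_leq // pdiv_dvd.
  apply/eqP => z; have := pch _ (pdiv_prime m1) z => ez.
  by move: z; rewrite ez => /eqP; rewrite (negbTE pR0).
have int0 (n : int) : (n%:~R : R) = 0 -> n = 0.
  case: n => [[|n]|n] // /eqP; first by rewrite -pmulrn (negbTE (natR0 _ _)).
  by rewrite NegzE mulrNz oppr_eq0 -pmulrn (negbTE (natR0 _ _)).
by move=> m n /eqP; rewrite -subr_eq0 -rmorphB /= => /eqP/int0/eqP;
  rewrite subr_eq0 => /eqP.
Qed.

Lemma finite_char_int (mu : {poly {poly R}}) : prime p ->
  completed_max_unramified p R -> nondegenerate_char mu ->
  finite_set (char_int mu).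
Proof.
move=> pp HR nd; have inj := int_inj_completed pp HR.
have nz : mu.[0] != 0.
  by apply/eqP => e; move: nd; rewrite /nondegenerate_char e horner0 unitr0.
apply: contrapT => inf.
have [B BK cB] := infinite_set_fset (size mu.[0]) inf.
have := @max_poly_roots _ mu.[0] [seq (n%:~R : R) | n <- B] nz.
rewrite map_inj_uniq // fset_uniq size_map ltnNge cB => H.
suff : false by []; apply: H => //.
by apply/allP => _ /mapP[n nB ->]; apply/eqP; exact: (BK n).
Qed.

Lemma mem_K_ (mu : {poly {poly R}}) s k : prime p ->
  completed_max_unramified p R -> nondegenerate_char mu ->
  k \in K_ mu s <-> char_int mu k /\ on_side s k.
Proof.
move=> pp HR nd; rewrite in_fset_set; first by rewrite inE.
by apply: sub_finite_set (finite_char_int pp HR nd) => x [].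
Qed.

Variables (phi : R -> R) (mu : {poly {poly R}}).

Lemma size_b_upto k n : size (b_upto p phi mu k n) = n.+1.
Proof. by elim: n => //= n IH; rewrite size_rcons IH. Qed.

Lemma nth_b_upto k n m : (m <= n)%N ->
  (b_upto p phi mu k n)`_m = b p phi mu k m.
Proof.
elim: n => [|n IH]; first by case: m.
rewrite leq_eqVlt ltnS => /predU1P[-> //|mn].
by rewrite /= nth_rcons size_b_upto ltnS mn IH.
Qed.

Lemma bE0 k : b p phi mu k 0 = 1.
Proof. by []. Qed.

Lemma bES k n : (0 < n)%N ->
  b p phi mu k n =
  - (\sum_(1 <= t < n.+1)
       (mu`_t).[(k * (p ^ (n - t))%N%:Z)%:~R] * iter t phi (b p phi mu k (n - t)))
  / (mu`_0).[(k * (p ^ n)%N%:Z)%:~R].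
Proof.
case: n => // n _; rewrite {1}/b /= nth_rcons size_b_upto ltnn eqxx.
congr (- _ / _); apply: eq_big_nat => t /andP[t0 tn].
by rewrite nth_b_upto // leq_subLR -add1n leq_add2r.
Qed.

Lemma basicE k alpha n : (1 < p)%N -> k != 0 ->
  basic p phi mu k alpha (k * (p ^ n)%N%:Z) = b p phi mu k n * iter n phi alpha.
Proof.
move=> p1 k0; rewrite /basic.
have np : (n < `|(k * (p ^ n)%N%:Z)%R|%N.+1)%N.
  rewrite ltnS abszM /= (leq_trans (ltnW (ltn_expl n p1))) //.
  by rewrite leq_pmull // absz_gt0.
rewrite (big_pred1 (Ordinal np)) // => m /=.
rewrite (inj_eq (mulfI k0)) eqz_nat eqn_exp2l // eq_sym.
by [].
Qed.

End Facts.

(* Main.v *)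
(** On the exponents k p^m with p not dividing k, the equation psi_a u = 0 reads
    mu(0,k) u_k = 0 for m = 0 and, for m > 0, expresses u_(k p^m) through the
    u_(k p^l), l < m, because mu(0, k p^m) = mu(0,0) mod p is a unit; this is
    the recursion of the b_(k,m).  Hence u is the sum of the basic series
    u_(k, u_k) over the characteristic integers k.

    The action of R by convolution requires every x in R to be a sum of
    f(z) z^k: since R/p is algebraically closed and algebraic over F_p, each
    nonzero residue is the reduction of z^k for a root of unity z, obtained as
    a Teichmueller representative, and one expands x in p-adic digits.  That
    phi z = z^p for all roots of unity z of R is where p <> 2 is needed. *)

Require Import Defs.
From HB Require Import structures.
From mathcomp Require Import all_boot all_order all_algebra finmap.
From mathcomp Require Import boolp classical_sets functions cardinality.
From mathcomp Require Import ring.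

Set Implicit Arguments.
Unset Strict Implicit.
Unset Printing Implicit Defensive.

Import Order.TTheory GRing.Theory Num.Theory.
Local Open Scope ring_scope.

(** * Congruences modulo powers of [p] *)

Section Divisibility.
Variables (p : nat) (A : comNzRingType).
Implicit Types (x y z : A) (N : nat).

Lemma pdvdr0 N : pdvd p N (0 : A).
Proof. by exists 0; rewrite mulr0. Qed.

Lemma pdvd_exp0 x : pdvd p 0 x.
Proof. by exists x; rewrite mul1r. Qed.

Lemma pdvdD N x y : pdvd p N x -> pdvd p N y -> pdvd p N (x + y).
Proof. by move=> [a ->] [c ->]; exists (a + c); rewrite mulrDr. Qed.

Lemma pdvdN N x : pdvd p N x -> pdvd p N (- x).
Proof. by move=> [a ->]; exists (- a); rewrite mulrN. Qed.

Lemma pdvdB N x y : pdvd p N x -> pdvd p N y -> pdvd p N (x - y).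
Proof. by move=> hx hy; apply/pdvdD/pdvdN. Qed.

Lemma pdvdBC N x y : pdvd p N (x - y) -> pdvd p N (y - x).
Proof. by move/pdvdN; rewrite opprB. Qed.

Lemma pdvd_trans N y x z :
  pdvd p N (x - y) -> pdvd p N (y - z) -> pdvd p N (x - z).
Proof. by move=> /pdvdD/[apply]; rewrite addrA subrK. Qed.

Lemma pdvd_mul M N x y : pdvd p M x -> pdvd p N y -> pdvd p (M + N) (x * y).
Proof. by move=> [a ->] [c ->]; exists (a * c); rewrite exprD mulrACA. Qed.

Lemma pdvd_mull N x y : pdvd p N y -> pdvd p N (x * y).
Proof. exact: (pdvd_mul (pdvd_exp0 x)). Qed.

Lemma pdvd_mulr N x y : pdvd p N x -> pdvd p N (x * y).
Proof. by rewrite mulrC; apply: pdvd_mull. Qed.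

Lemma pdvd_le M N x : (M <= N)%N -> pdvd p N x -> pdvd p M x.
Proof.
by move=> MN [a ->]; exists (p%:R ^+ (N - M) * a); rewrite mulrA -exprD subnKC.
Qed.

Lemma pdvd_pexp N : pdvd p N (p%:R ^+ N : A).
Proof. by exists 1; rewrite mulr1. Qed.

Lemma pdvd_p : pdvd p 1 (p%:R : A).
Proof. exact: pdvd_pexp 1%N. Qed.

Lemma pdvd_sum N (I : Type) (r : seq I) (P : pred I) (F : I -> A) :
  (forall i, P i -> pdvd p N (F i)) -> pdvd p N (\sum_(i <- r | P i) F i).
Proof. by move=> h; apply: big_ind => //; [exact: pdvdr0 | exact: pdvdD]. Qed.

Lemma pdvd_congX N n x y : pdvd p N (x - y) -> pdvd p N (x ^+ n - y ^+ n).
Proof. by move=> h; rewrite subrXX; apply: pdvd_mulr. Qed.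

(** The cofactor of [x - y] in [x ^+ p - y ^+ p] has [p] terms, each congruent to [y ^+ p.-1] modulo
    [p] because [0 < N]; it therefore contributes one more factor [p]. *)
Lemma pdvd_congXp N x y : (0 < N)%N ->
  pdvd p N (x - y) -> pdvd p N.+1 (x ^+ p - y ^+ p).
Proof.
move=> N0 h; rewrite subrXX -addn1; apply: pdvd_mul => //.
rewrite -[\sum_(_ < _) _](subrK (\sum_(i < p) y ^+ p.-1)); apply: pdvdD.
  rewrite -sumrB; apply: pdvd_sum => i _.
  have ip : (i <= p.-1)%N by case: p i => [[]|q i] //; rewrite -ltnS.
  rewrite -{2}(subnK ip) exprD -mulrBl; apply/pdvd_mulr/pdvd_congX.
  exact: pdvd_le h.
by rewrite sumr_const card_ord -mulr_natr; apply/pdvd_mull/pdvd_p.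
Qed.

Lemma pdvd_congXpX N a x y : (0 < N)%N ->
  pdvd p N (x - y) -> pdvd p (N + a) (x ^+ (p ^ a) - y ^+ (p ^ a)).
Proof.
move=> N0 h; elim: a => [|a IH]; first by rewrite addn0 !expr1.
by rewrite expnSr !exprM addnS; apply: pdvd_congXp; rewrite // addn_gt0 N0.
Qed.

Lemma padic_cauchyS (u : nat -> A) :
  (forall n, pdvd p n (u n.+1 - u n)) -> padic_cauchy p u.
Proof.
move=> h N; exists N.
have H n : (N <= n)%N -> pdvd p N (u n - u N).
  elim: n => [|n IH].
    by rewrite leqn0 => /eqP ->; rewrite subrr; exact: pdvdr0.
  rewrite leq_eqVlt => /predU1P[->|]; first by rewrite subrr; exact: pdvdr0.
  rewrite ltnS => Nn; apply: (@pdvd_trans _ (u n)); last exact: IH.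
  exact: pdvd_le (h n).
by move=> m n /H hm /H /pdvdBC hn; apply: pdvd_trans hm hn.
Qed.

(** Both sides are compared with a term far out, since all successive differences from index [n] on
    are divisible by [p ^ n]. This turns convergence into an explicit precision. *)
Lemma padic_limS (u : nat -> A) l :
  (forall n, pdvd p n (u n.+1 - u n)) -> padic_lim p u l ->
  forall n, pdvd p n (l - u n).
Proof.
move=> h ul n; have [n0 hn] := ul n.
have H m : pdvd p n (u (n + m)%N - u n).
  elim: m => [|m IH]; first by rewrite addn0 subrr; exact: pdvdr0.
  apply: pdvd_trans IH; rewrite addnS; apply: pdvd_le (h _); exact: leq_addr.
by apply: pdvd_trans (H n0); apply/pdvdBC/hn; rewrite leq_addl.
Qed.

End Divisibility.

Lemma pdvd_morph (p N : nat) (A B : comNzRingType) (f : {rmorphism A -> B}) x :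
  pdvd p N x -> pdvd p N (f x).
Proof. by move=> [a ->]; exists (f a); rewrite rmorphM rmorphXn rmorph_nat. Qed.

(** * Units and residues of [R] *)

Section CompletedRing.
Variables (p : nat) (R : idomainType).
Hypotheses (pp : prime p) (HR : completed_max_unramified p R).

Lemma pdvd_separated (x : R) : (forall N, pdvd p N x) -> x = 0.
Proof. by case: HR => Zp [A [i [j [_ _ cR]]]]; apply: (pc_separated cR). Qed.

Lemma padic_complete (u : nat -> R) :
  padic_cauchy p u -> exists l, padic_lim p u l.
Proof. by case: HR => Zp [A [i [j [_ _ cR]]]]; apply: (pc_complete cR). Qed.

(** Otherwise every power of [p] would divide 1, against separatedness. *)
Lemma pdvd_neq1 : ~ pdvd p 1 (1 : R).
Proof.
move=> h; apply/(elimF eqP (oner_eq0 R))/pdvd_separated => N.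
elim: N => [|N IH]; first exact: pdvd_exp0.
by rewrite -addn1 -[1]mulr1; apply: pdvd_mul.
Qed.

Lemma natr_neq0 n : (0 < n)%N -> (n%:R : R) != 0.
Proof.
move=> n0; have e := inj_eq (int_inj_completed pp HR).
by rewrite -[0]/(0%:~R) -[n%:R]/(n%:Z%:~R) e eqz_nat -lt0n.
Qed.

(** The inverse is the sum of the geometric series in [1 - x]. *)
Lemma unit_near1 (x : R) : pdvd p 1 (x - 1) -> x \is a GRing.unit.
Proof.
move=> /pdvdBC [w]; rewrite expr1 => xE.
pose u n := \sum_(i < n) (1 - x) ^+ i.
have uS n : pdvd p n (u n.+1 - u n).
  rewrite /u big_ord_recr /= addrAC subrr add0r xE exprMn.
  exact/pdvd_mulr/pdvd_pexp.
have [l /(padic_limS uS) lu] := padic_complete (padic_cauchyS uS).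
apply/unitrP; exists l; rewrite mulrC; suff -> : x * l = 1 by [].
apply/eqP; rewrite -subr_eq0; apply/eqP/pdvd_separated => N.
apply: (@pdvd_trans _ _ _ (x * u N)); first by rewrite -mulrBr; apply/pdvd_mull.
have -> : x * u N - 1 = - (1 - x) ^+ N.
  rewrite -[x in x * _](subKr 1) -opprB mulNr /u -subrX1.
  by rewrite opprB addrAC subrr sub0r.
by apply: pdvdN; rewrite xE exprMn; apply/pdvd_mulr/pdvd_pexp.
Qed.

Lemma unit_near (x y : R) :
  y \is a GRing.unit -> pdvd p 1 (x - y) -> x \is a GRing.unit.
Proof.
move=> uy h; rewrite -(mulrVK uy x) unitrM uy andbT; apply: unit_near1.
by rewrite -(mulrV uy) -mulrBl; apply: pdvd_mulr.
Qed.

(** By density [x] may be replaced modulo [p] by the image of some [a] in [A], and [A] is local with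
    maximal ideal [pA]. *)
Lemma residue_inv (x : R) : ~ pdvd p 1 x -> exists y, pdvd p 1 (x * y - 1).
Proof.
case: HR => Zp [A [i [j [_ mA cR]]]] nx.
have [a xa] := pc_dense cR 1 x.
have /(unr_local mA) ua : ~ pdvd p 1 a.
  by move/(pdvd_morph j)/(pdvdD xa); rewrite subrK.
exists (j a^-1); rewrite -(rmorph1 j) -(mulrV ua) rmorphM -mulrBl.
exact: pdvd_mulr.
Qed.

Lemma residue_root n (x : R) : (0 < n)%N -> exists y, pdvd p 1 (y ^+ n - x).
Proof.
case: HR => Zp [A [i [j [_ mA cR]]]] n0.
have [a xa] := pc_dense cR 1 x.
have [||y hy] := @unr_maximal _ _ _ _ mA ('X^n - a%:P).
- exact: monicXnsubC.
- by rewrite size_XnsubC // ltnS.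
exists (j y); apply: pdvd_trans (pdvdBC xa).
by move/(pdvd_morph j): hy; rewrite !hornerE rmorphB rmorphXn.
Qed.

(** Pigeonhole: an integral element has all its powers in the span over [Zp] of finitely many of
    them, and modulo [p] the coefficients take finitely many values. *)
Lemma residue_power_cycle (x : R) : exists a h,
  pdvd p 1 (x ^+ (p ^ a) - x ^+ (p ^ (a + h.+1))).
Proof.
case: HR => Zp [A [i [j [cZ mA cR]]]].
have [a xa] := pc_dense cR 1 x.
suff [m [h H]] : exists m h, pdvd p 1 (a ^+ (p ^ m) - a ^+ (p ^ (m + h.+1))).
  exists m, h; apply: (pdvd_trans (pdvd_congX _ xa)).
  apply: pdvd_trans (pdvdBC (pdvd_congX _ xa)).
  by rewrite -!rmorphXn -rmorphB; apply: pdvd_morph.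
(* Integers are dense in [Zp], so the remainder modulo [p] of an approximating integer represents
   the residue of [z]. *)
have /choice[c Hc] : forall z : Zp, exists c : 'I_p, pdvd p 1 (z - c%:R).
  move=> z; have [n zn] := pc_dense cZ 1 z.
  have p0 : (p%:Z != 0) by rewrite eqz_nat -lt0n prime_gt0.
  have rp : (`|(n %% p)%Z|%N < p)%N.
    by rewrite -ltz_nat gez0_abs ?modz_ge0 // ltz_pmod // ltz_nat prime_gt0.
  exists (Ordinal rp); apply: pdvd_trans zn _ => /=.
  rewrite {1}(divz_eq n p) -[_%:R]/(`|(n %% p)%Z|%N%:Z%:~R).
  rewrite gez0_abs ?modz_ge0 // rmorphD addrK rmorphM /=.
  exact/pdvd_mull/pdvd_p.
have [P mP Pa] := unr_integral mA a.
pose r n : {poly Zp} := Pdiv.Ring.rmodp 'X^(p ^ n) P.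
have rE n : a ^+ (p ^ n) = \sum_(k < size P) i (r n)`_k * a ^+ k.
  have sr : (size (map_poly i (r n)) <= size P)%N.
    rewrite (leq_trans (size_poly _ _)) // ltnW //.
    by rewrite Pdiv.Ring.ltn_rmodpN0 // ?monic_neq0.
  transitivity (map_poly i (r n)).[a].
    have /(congr1 (fun q => (map_poly i q).[a])) :=
      Pdiv.RingMonic.rdivp_eq mP 'X^(p ^ n).
    rewrite rmorphD rmorphM map_polyXn !hornerE (rootP Pa) mulr0 add0r.
    by [].
  by rewrite (horner_coef_wide _ sr); apply: eq_bigr => k _; rewrite coef_map.
(* There is one more exponent than there are coefficient vectors modulo [p], so two exponents share
   a vector. *)
pose T := {ffun 'I_(size P) -> 'I_p}.
pose G (n : 'I_(#|T|.+1)) : T := [ffun k : 'I_(size P) => c (r n)`_k].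
have : ~ injective G by move/leq_card; rewrite card_ord ltnn.
suff H (m n : 'I_(#|T|.+1)) : (m < n)%N -> G m = G n ->
    exists m h, pdvd p 1 (a ^+ (p ^ m) - a ^+ (p ^ (m + h.+1))).
  move=> nG; apply: contrapT => nH; apply: nG => m n e.
  by apply/val_inj; case: (ltngtP m n) => // [/H/(_ e)|/H/(_ (esym e))].
move=> mn e; exists m, (n - m.+1)%N.
rewrite -addSnnS subnKC // !rE -sumrB; apply: pdvd_sum => k _.
rewrite -mulrBl -rmorphB; apply/pdvd_mulr/pdvd_morph.
move/ffunP/(_ k): e; rewrite !ffunE => e.
by apply: pdvd_trans (Hc _) _; rewrite e; apply: pdvdBC.
Qed.

End CompletedRing.

(** * Teichmueller representatives, and the Frobenius lift on roots of unity *)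

Section Frobenius.
Variables (p : nat) (R : idomainType) (phi : {rmorphism R -> R}).
Hypotheses (pp : prime p) (p2 : p <> 2%N) (HR : completed_max_unramified p R).
Hypothesis Hphi : frobenius_lift p phi.

(** Since [phi] is bijective and fixes [p], the cofactor can be pulled back. *)
Lemma frob_pdvdI n N (x : R) : pdvd p N (iter n phi x) -> pdvd p N x.
Proof.
case: Hphi => -[psi phiK psiK] _; elim: n => // n IH [y] /= E; apply: IH.
exists (psi y); apply: (can_inj phiK).
by rewrite E rmorphM rmorphXn rmorph_nat psiK.
Qed.

Lemma iter_frob_cong n (x : R) : pdvd p 1 (iter n phi x - x ^+ (p ^ n)).
Proof.
case: Hphi => _ Hp; elim: n => [|n IH] /=.
  by rewrite subrr; exact: pdvdr0.
by apply: pdvd_trans (Hp _) _; rewrite expnSr exprM; apply: pdvd_congX.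
Qed.

Lemma iter_frobB n (x y : R) : iter n phi (x - y) = iter n phi x - iter n phi y.
Proof. by elim: n => //= n ->; rewrite rmorphB. Qed.

Lemma iter_frobM n (x y : R) : iter n phi (x * y) = iter n phi x * iter n phi y.
Proof. by elim: n => //= n ->; rewrite rmorphM. Qed.

Lemma iter_frobD n (x y : R) : iter n phi (x + y) = iter n phi x + iter n phi y.
Proof. by elim: n => //= n ->; rewrite rmorphD. Qed.

Lemma iter_frob0 n : iter n phi 0 = 0.
Proof. by elim: n => //= n ->; rewrite rmorph0. Qed.

(* In x^(p^a) = x^(p^(a+h)) mod p the power p^a can be cancelled because the
   automorphism phi^a is the p^a-power map mod p. *)
Lemma residue_algebraic (x : R) : exists h, pdvd p 1 (x ^+ (p ^ h.+1) - x).
Proof.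
have [a [h xah]] := residue_power_cycle pp HR x; exists h.
apply: pdvd_trans (pdvdBC (iter_frob_cong _ _)) _; apply: (@frob_pdvdI a).
rewrite iter_frobB -iterD; apply: pdvd_trans (iter_frob_cong _ _) _.
by apply: pdvd_trans (pdvdBC xah) (pdvdBC (iter_frob_cong _ _)).
Qed.

(** With [q = p ^ h.+1] and [x ^+ q] congruent to [x] modulo [p], the powers [x ^+ (q ^ n)] form a
    Cauchy sequence; its limit is unchanged by raising to the power [q]. *)
Lemma teichmuller (x : R) :
  exists w h, pdvd p 1 (w - x) /\ w ^+ (p ^ h.+1) = w.
Proof.
have [h xh] := residue_algebraic x; pose q := (p ^ h.+1)%N.
pose u n := x ^+ (q ^ n).
have uS n : pdvd p n (u n.+1 - u n).
  rewrite /u expnS exprM -[(q ^ n)%N]expnM.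
  apply: (@pdvd_le _ _ _ (1 + h.+1 * n)); last exact: pdvd_congXpX.
  by rewrite addnC mulSn -addnA leq_addr.
have [w /(padic_limS uS) wu] := padic_complete HR (padic_cauchyS uS).
exists w, h; split; first by apply: pdvd_trans (wu 1%N) _; rewrite /u expn1.
apply/eqP; rewrite -subr_eq0; apply/eqP/(pdvd_separated HR) => N.
apply: pdvd_trans (pdvd_congX _ (wu N)) _.
rewrite -exprM -expnSr; apply: pdvd_trans (uS N) _; exact/pdvdBC.
Qed.

Lemma root_of_unity_lift k (x : R) : k != 0 -> ~ pdvd p 1 x ->
  exists z, mu_roots z /\ pdvd p 1 (x - z ^ k).
Proof.
move=> k0 nx.
(* For positive exponents, take the Teichmueller representative of an [n]-th root of the residue of
   [y]. *)
have H n (y : R) : (0 < n)%N -> ~ pdvd p 1 y ->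
    exists z, mu_roots z /\ pdvd p 1 (z ^+ n - y).
  move=> n0 ny; have [t ty] := residue_root HR y n0.
  have [w [h [wt wq]]] := teichmuller t; exists w.
  have wy : pdvd p 1 (w ^+ n - y) by apply: pdvd_trans ty; apply: pdvd_congX.
  split=> //; have q1 : (1 < p ^ h.+1)%N.
    by rewrite -(exp1n h.+1) ltn_exp2r ?prime_gt1.
  (* Being nonzero, [w] can be cancelled from [w ^+ (p ^ h.+1) = w], which makes it a root of
     unity. *)
  have w0 : w != 0.
    apply/eqP => w0; apply: ny; move: wy.
    by rewrite w0 expr0n eqn0Ngt n0 sub0r => /pdvdN; rewrite opprK.
  exists (p ^ h.+1).-1; first by case: (p ^ _)%N q1 => [|[]].
  apply: (mulfI w0); rewrite mulr1 -exprS prednK //; exact: ltnW.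
case: k k0 => n k0.
  have [|z [zmu zx]] := H n x _ nx; first by rewrite lt0n.
  by exists z; split=> //; apply: pdvdBC.
(* For a negative exponent, the positive case is applied to the inverse of the residue of [x]. *)
have [y xy] := residue_inv HR nx.
have [||z [zmu zy]] := H n.+1 y.
- by [].
- move=> py; apply: (pdvd_neq1 HR); rewrite -[1](subKr (x * y)).
  by apply: pdvdB => //; apply: pdvd_mull.
exists z; split=> //; have [m m0 zm] := zmu.
have uz : z ^+ n.+1 \is a GRing.unit.
  apply: unitrX; apply/unitrP; exists (z ^+ m.-1).
  by rewrite -exprS -exprSr prednK.
rewrite NegzE -exprnN -[x](mulrK uz) -[X in _ - X]mul1r -mulrBl.
apply: pdvd_mulr; apply: pdvd_trans xy.
by rewrite -mulrBr; apply: pdvd_mull.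
Qed.

(** By Bezout, an [n] prime to [p] would force [p] to divide 1 in [R]. *)
Lemma natr_pdvd n : pdvd p 1 (n%:R : R) -> (p %| n)%N.
Proof.
move=> pn; apply: contrapT => /negP; rewrite -prime_coprime // => co.
have [a _] := Bezoutl n (prime_gt0 pp); rewrite (eqP co) => /dvdnP[c].
move/(congr1 (fun m => m%:R : R)); rewrite natrD !natrM => E.
apply: (pdvd_neq1 HR); rewrite -[1](addrK (a%:R * n%:R)) E.
by apply: pdvdB; apply: pdvd_mull => //; exact: pdvd_p.
Qed.

(** First-order binomial expansion: the error is a multiple of [(z - 1) ^+ 2]. *)
Lemma pdvd2_expr i (z : R) :
  pdvd p 1 (z - 1) -> pdvd p 2 (z ^+ i - (1 + i%:R * (z - 1))).
Proof.
move=> z1; elim: i => [|i IH].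
  by rewrite mul0r addr0 subrr; exact: pdvdr0.
have -> : z ^+ i.+1 - (1 + i.+1%:R * (z - 1)) =
    z * (z ^+ i - (1 + i%:R * (z - 1))) + i%:R * ((z - 1) * (z - 1)).
  by rewrite exprS -natr1; ring.
by apply: pdvdD; apply: pdvd_mull => //; apply: (@pdvd_mul _ _ 1 1).
Qed.

(* This fails for p = 2, with z = -1. *)
Lemma prime_root_near1 q (z : R) :
  prime q -> pdvd p 1 (z - 1) -> z ^+ q = 1 -> z = 1.
Proof.
move=> pq z1 zq; have /eqP := subrX1 z q.
rewrite zq subrr eq_sym mulf_eq0 subr_eq0 => /predU1P[//|/eqP S0]; exfalso.
have [qp|qp] := eqVneq q p.
  (* If [z] is not 1, the sum of the [z ^+ i] vanishes. Modulo [p ^ 2] it equals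
     [p + 'C(p, 2) * (z - 1)], whose second term is 0 because [p] is odd and so divides
     ['C(p, 2)]. *)
  have : pdvd p 2 (p%:R : R).
    rewrite -[p%:R]subr0 -S0 qp -[p in p%:R]card_ord -sumr_const.
    have -> : \sum_(i < p) 1 - \sum_(i < p) z ^+ i =
        \sum_(i < p) i%:R * (1 - z) -
        \sum_(i < p) (z ^+ i - (1 + i%:R * (z - 1))).
      by rewrite -!sumrB; apply: eq_bigr => i _; ring.
    apply: pdvdB; last by apply: pdvd_sum => i _; apply: pdvd2_expr.
    rewrite -mulr_suml -natr_sum; apply: (@pdvd_mul _ _ 1 1); last exact: pdvdBC.
    rewrite -(big_mkord predT id) bin2_sum.
    have /dvdnP[c ->] : (p %| 'C(p, 2))%N.
      by apply: prime_dvd_bin => //; case: p pp p2 => [|[|[|]]].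
    by rewrite natrM; apply/pdvd_mull/pdvd_p.
  move=> [y]; rewrite expr2 -mulrA -[X in X = _]mulr1.
  move/(mulfI (natr_neq0 pp HR (prime_gt0 pp))) => E; apply: (pdvd_neq1 HR).
  by exists y; rewrite expr1.
(* For [q] other than [p], the vanishing sum is already congruent to [q] modulo [p]. *)
move/negP: qp; apply; rewrite eq_sym -dvdn_prime2 //; apply: natr_pdvd.
rewrite -[q%:R]subr0 -S0 -[q in q%:R]card_ord -sumr_const -sumrB.
by apply: pdvd_sum => i _; rewrite -(expr1n _ i); apply/pdvd_congX/pdvdBC.
Qed.

(** Induction on [n]: for its least prime factor [l], the power [z ^+ l] is again near 1 and has
    order dividing [n / l], which reduces to prime order. *)
Lemma root_near1 n (z : R) :
  (0 < n)%N -> pdvd p 1 (z - 1) -> z ^+ n = 1 -> z = 1.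
Proof.
elim/ltn_ind: n z => n IH z n0 z1 zn.
have [n1|n1] := leqP n 1.
  have -> : z = z ^+ n by rewrite (_ : n = 1%N) //; apply/eqP;
    rewrite eqn_leq n1.
  exact: zn.
have pq := pdiv_prime n1; apply: (prime_root_near1 pq) => //.
apply: (IH (n %/ pdiv n)%N).
- by rewrite ltn_Pdiv // prime_gt1.
- by rewrite divn_gt0 ?pdiv_gt0 // pdiv_leq.
- by rewrite -(expr1n _ (pdiv n)); apply: pdvd_congX.
- by rewrite -exprM mulnC divnK // pdiv_dvd.
Qed.

Lemma mu_roots_unit (z : R) : mu_roots z -> z \is a GRing.unit.
Proof.
move=> [n n0 zn]; apply/unitrP; exists (z ^+ n.-1).
by rewrite -exprS -exprSr prednK.
Qed.

(** The quotient of the two sides is a root of unity congruent to 1 modulo [p]. *)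
Lemma frob_root (z : R) : mu_roots z -> phi z = z ^+ p.
Proof.
move=> zmu; have uz := unitrX p (mu_roots_unit zmu).
have [n n0 zn] := zmu; rewrite -(mulrVK uz (phi z)).
suff -> : phi z / z ^+ p = 1 by rewrite mul1r.
apply: (root_near1 n0).
  by rewrite -(mulrV uz) -mulrBl; apply/pdvd_mulr; case: Hphi => _; apply.
rewrite exprMn exprVn -rmorphXn -exprM mulnC exprM zn.
by rewrite rmorph1 expr1n invr1 mulr1.
Qed.

(** Integers are fixed by [phi] and approximate [x] to any precision. *)
Lemma frob_Zp (x : R) : in_Zp p x -> phi x = x.
Proof.
move=> Zx; apply/eqP; rewrite -subr_eq0; apply/eqP/(pdvd_separated HR) => N.
have [m xm] := Zx N; apply: pdvd_trans (pdvdBC xm).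
by rewrite -(rmorph_int phi) -rmorphB; apply: pdvd_morph.
Qed.

End Frobenius.

(** * Unconditional [p]-adic sums *)

Section Summation.
Variables (p : nat) (R : idomainType).
Hypothesis HR : completed_max_unramified p R.
Implicit Types (g : R -> R) (f : R -> R).

Lemma padic_sum_uniq g s t : padic_sum p g s -> padic_sum p g t -> s = t.
Proof.
move=> gs gt; apply/eqP; rewrite -subr_eq0; apply/eqP/(pdvd_separated HR) => N.
have [F HF] := gs N; have [G HG] := gt N.
have /pdvd_trans := HF _ (fsubsetUl F G); apply.
exact/pdvdBC/HG/fsubsetUr.
Qed.

Lemma psumE g s : padic_sum p g s -> psum p g = s.
Proof. by move=> gs; apply: xget_unique => // t /padic_sum_uniq; apply. Qed.

Lemma padic_sum0 : padic_sum p (fun=> 0 : R) 0.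
Proof.
by move=> N; exists fset0 => G _; rewrite big1 // subrr; exact: pdvdr0.
Qed.

Lemma padic_sum_mulr g s c :
  padic_sum p g s -> padic_sum p (fun z => g z * c) (s * c).
Proof.
move=> gs N; have [F HF] := gs N; exists F => G /HF h.
by rewrite -mulr_suml -mulrBl; apply: pdvd_mulr.
Qed.

Lemma padic_sum_morph (phi : {rmorphism R -> R}) g s :
  padic_sum p g s -> padic_sum p (phi \o g) (phi s).
Proof.
move=> gs N; have [F HF] := gs N; exists F => G /HF h.
by rewrite -rmorph_sum -rmorphB; apply: pdvd_morph.
Qed.

Lemma pdvd_sum_fsetB N (F G : {fset R}) g : (F `<=` G)%fset ->
  (forall z, z \notin F -> pdvd p N (g z)) ->
  pdvd p N (\sum_(z <- G) g z - \sum_(z <- F) g z).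
Proof.
move=> FG gF; pose g' z := if z \in F then g z else 0.
have -> : \sum_(z <- F) g z = \sum_(z <- G) g' z.
  rewrite -(big_fset_incl _ FG); last by move=> z _ /negbTE zF; rewrite /g' zF.
  by apply: eq_big_seq => z zF; rewrite /g' zF.
rewrite -sumrB; apply: pdvd_sum => z _; rewrite /g'.
by case: ifPn => [_|/gF]; rewrite ?subrr ?subr0 //; exact: pdvdr0.
Qed.

(** The finite sets [B N] of indices whose term is not divisible by [p ^ N] increase with [N], and
    the sums over them form a Cauchy sequence. *)
Lemma padic_summable g :
  (forall N, finite_set [set z | ~ pdvd p N (g z)]%classic) ->
  exists s, padic_sum p g s.
Proof.
move=> fin; pose B N := fset_set [set z | ~ pdvd p N (g z)]%classic.
have memB N z : z \notin B N -> pdvd p N (g z).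
  move=> zB; apply: contrapT => h; move/negP: zB; apply.
  by rewrite in_fset_set // inE.
have BS N : (B N `<=` B N.+1)%fset.
  apply/fsubsetP => z; rewrite !in_fset_set // !inE /= => h h'; apply: h.
  exact: pdvd_le h'.
pose u N := \sum_(z <- B N) g z.
have uS N : pdvd p N (u N.+1 - u N) by apply: pdvd_sum_fsetB => // z /memB.
have [s /(padic_limS uS) su] := padic_complete HR (padic_cauchyS uS).
exists s => N; exists (B N) => G BG; apply: pdvd_trans (su N) _.
by apply/pdvdBC/pdvd_sum_fsetB => // z /memB.
Qed.

Lemma ev_char_sum k f : completed_group_ring p f ->
  padic_sum p (fun z => f z * z ^ k) (ev_char p k f).
Proof.
move=> [_ _ fin]; have [|s hs] := @padic_summable (fun z => f z * z ^ k).
  by move=> N; apply: sub_finite_set (fin N) => z /= h h'; apply/h/pdvd_mulr.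
by rewrite /ev_char (psumE hs).
Qed.

End Summation.

(** * Evaluation of the completed group ring, and convolution on basic series *)

Section Surjectivity.
Variables (p : nat) (R : idomainType) (phi : {rmorphism R -> R}).
Hypotheses (pp : prime p) (p2 : p <> 2%N) (HR : completed_max_unramified p R).
Hypothesis Hphi : frobenius_lift p phi.

(** The [k]-th powers of roots of unity, together with 0, represent all residues and can serve as
    [p]-adic digits; [e] marks the nonzero digits. *)
Lemma root_of_unity_digits k (x : R) : k != 0 ->
  exists (z : nat -> R) (e : nat -> bool),
    (forall n, mu_roots (z n)) /\
    forall n, pdvd p n (x - \sum_(m < n) (e m * p ^ m)%N%:R * z m ^ k).
Proof.
move=> k0.
have /choice[D HD] : forall y : R, exists d : R * bool * R,
    mu_roots d.1.1 /\ y = d.1.2%:R * d.1.1 ^ k + p%:R * d.2.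
  move=> y; have [[w yw]|ny] := pselect (pdvd p 1 y).
    (* The digit is 0 here, and the root 1 is only a placeholder. *)
    exists (1, false, w); split; first by exists 1%N; rewrite ?expr1n.
    by rewrite mul0r add0r /= yw expr1.
  have [z [zmu [w yw]]] := root_of_unity_lift pp HR Hphi k0 ny.
  exists (z, true, w); split=> //=.
  by rewrite mul1r -[y](subrK (z ^ k)) yw expr1 addrC.
(* [r n] is what is left of [x] after [n] digits, divided by [p ^ n]. *)
pose r n := iter n (fun y => (D y).2) x.
exists (fun n => (D (r n)).1.1), (fun n => (D (r n)).1.2); split.
  by move=> n; have [] := HD (r n).
move=> n; exists (r n); elim: n => [|n IH].
  by rewrite big_ord0 subr0 mul1r.
rewrite big_ord_recr /= opprD addrA IH; have [_] := HD (r n).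
rewrite -[(D (r n)).2]/(r n.+1) => {1}->.
by rewrite natrM natrX exprSr; ring.
Qed.

(** Digits are collected by root: [f z] is the sum of the [p ^ m] over the nonzero digits with root
    [z], and [F n z] is its partial sum over the first [n] digits. *)
Lemma ev_char_surj k (x : R) : k != 0 ->
  exists f, completed_group_ring p f /\ ev_char p k f = x.
Proof.
move=> k0; have [w [e [wmu xE]]] := root_of_unity_digits x k0.
pose F n z := (\sum_(m < n) (w m == z) * (e m * p ^ m))%N.
have FS z n : pdvd p n ((F n.+1 z)%:R - (F n z)%:R : R).
  rewrite /F big_ord_recr /= natrD addrAC subrr add0r mulnA natrM natrX.
  exact/pdvd_mull/pdvd_pexp.
have /choice[f fF] : forall z, exists y : R,
    forall n, pdvd p n (y - (F n z)%:R).
  move=> z; have [l /(padic_limS (FS z))] :=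
    padic_complete HR (padic_cauchyS (FS z)); by exists l.
have F0 N z : z \notin [seq w m | m <- iota 0 N] -> F N z = 0%N.
  move=> zN; rewrite /F big1 // => m _; case: eqP => // wz; case/negP: zN.
  by rewrite -wz map_f // mem_iota add0n ltn_ord.
exists f; split.
  split=> [z nz|z N|N].
  - apply: (pdvd_separated HR) => N; have := fF z N.
    rewrite /F big1 ?subr0 // => m _; case: eqP => // wz.
    by case: nz; rewrite -wz.
  - by exists (F N z)%:Z; apply: fF.
  apply: sub_finite_set (finite_seq [seq w m | m <- iota 0 N]) => z /= h.
  apply: contrapT => /negP/F0 z0; apply: h.
  by have := fF z N; rewrite z0 subr0.
(* Roots that do not occur among the first [N] digits have coefficients divisible by [p ^ N]. *)
apply: psumE => // N; exists [fset z in [seq w m | m <- iota 0 N]]%fset => G wG.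
apply: pdvd_trans (xE N) _.
have -> : \sum_(m < N) (e m * p ^ m)%N%:R * w m ^ k =
    \sum_(z <- G) (F N z)%:R * z ^ k.
  under [RHS]eq_bigr do rewrite natr_sum mulr_suml.
  rewrite exchange_big; apply: eq_bigr => m _.
  rewrite (bigD1_seq (w m)) ?fset_uniq //=; last first.
    by apply: (fsubsetP wG); rewrite inE /= map_f // mem_iota add0n ltn_ord.
  rewrite eqxx mul1n big1 ?addr0 // => z; rewrite eq_sym => /negbTE ->.
  by rewrite mul0n mul0r.
rewrite -sumrB; apply: pdvd_sum => z _; rewrite -mulrBl.
exact/pdvd_mulr/pdvdBC/fF.
Qed.

(** Termwise, [phi] fixes the [p]-adic integer [f z] and raises the root [z] to the power [p], so
    each application multiplies the exponent by [p]. *)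
Lemma iter_frob_ev_char k m f : completed_group_ring p f ->
  padic_sum p (fun z => f z * z ^ (k * (p ^ m)%N%:Z))
    (iter m phi (ev_char p k f)).
Proof.
move=> Hf; elim: m => [|m IH].
  by rewrite expn0 mulr1; apply: ev_char_sum.
have := padic_sum_morph phi IH; congr padic_sum; apply/funext => z /=.
have [f0 fZ _] := Hf; rewrite rmorphM (frob_Zp phi HR (fZ z)).
have [zmu|/f0 ->] := pselect (mu_roots z); last by rewrite !mul0r.
rewrite rmorphXz ?mu_roots_unit // (frob_root pp p2 HR Hphi zmu).
by rewrite exprnP exprz_exp mulrCA expnS PoszM.
Qed.

Lemma basic0 (mu : {poly {poly R}}) k (a : R) n :
  (forall m, n != k * (p ^ m)%N%:Z) -> basic p phi mu k a n = 0.
Proof. by move=> h; rewrite /basic big_pred0 // => m; apply/negbTE. Qed.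

(** Convolution multiplies the coefficient at [k * p ^ m] by the evaluation of [f] at that exponent,
    which is the [m]-fold Frobenius twist of [ev_char p k f]; a basic series twists its parameter in
    the same way. *)
Lemma conv_basic (mu : {poly {poly R}}) k f (a : R) :
  k != 0 -> completed_group_ring p f ->
  conv p f (basic p phi mu k a) = basic p phi mu k (ev_char p k f * a).
Proof.
move=> k0 Hf; apply/funext => n; apply: psumE => //.
have [[m ->]|nm] := pselect (exists m, n = k * (p ^ m)%N%:Z); last first.
  have {}nm m : n != k * (p ^ m)%N%:Z by apply/eqP => e; apply: nm; exists m.
  rewrite !basic0 // (_ : (fun z => _) = fun=> 0); first exact: padic_sum0.
  by apply/funext => z; rewrite mulr0.
rewrite !basicE ?prime_gt1 // iter_frobM mulrCA.
exact/padic_sum_mulr/iter_frob_ev_char.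
Qed.

End Surjectivity.

(** * The operator [psi_a] along the exponents [k * p ^ m] *)

Section SeriesOperators.
Variables (p : nat) (R : idomainType) (phi : {rmorphism R -> R}).
Hypothesis pp : prime p.
Implicit Types (u v : int -> R) (k n : int).

(** Splits the nonzero exponents into the classes on which the equation [psi_a u = 0] decouples. *)
Lemma int_ppart n : n != 0 ->
  exists k m, ~~ (p %| k)%Z /\ n = k * (p ^ m)%N%:Z.
Proof.
move=> n0; have an0 : (0 < `|n|)%N by rewrite absz_gt0.
have [c co nE] := pfactor_coprime pp an0.
exists (sgz n * c%:Z), (logn p `|n|%N); split; last first.
  by rewrite -mulrA -PoszM -nE -intEsg.
by rewrite dvdzE abszM absz_sg n0 mul1n -prime_coprime.
Qed.

Lemma int_ppart_uniq (k l : int) (m n : nat) : ~~ (p %| k)%Z -> ~~ (p %| l)%Z ->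
  k * (p ^ m)%N%:Z = l * (p ^ n)%N%:Z -> k = l /\ m = n.
Proof.
wlog mn : k l m n / (m <= n)%N.
  move=> H; have [/H|/ltnW/H h pk pl /esym e] := leqP m n; first exact.
  by have [-> ->] := h _ _ pl pk e.
move=> pk pl; rewrite -(subnK mn) expnD PoszM mulrA.
have q0 : (p ^ m)%N%:Z != 0 by rewrite eqz_nat -lt0n expn_gt0 prime_gt0.
move/(mulIf q0); case: (n - m)%N => [|d] e; first by rewrite e expn0 mulr1.
by case/negP: pk; rewrite e expnSr PoszM mulrA dvdz_mull.
Qed.

Lemma on_side_ppart s k m : on_side s (k * (p ^ m)%N%:Z) = on_side s k.
Proof.
have q0 : 0 < (p ^ m)%N%:Z by rewrite ltz_nat expn_gt0 prime_gt0.
by case: s; rewrite /= ?pmulr_lgt0 ?pmulr_llt0.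
Qed.

Lemma iter_phi_p i v n :
  iter i (phi_p p phi) v (n * (p ^ i)%N%:Z) = iter i phi (v n).
Proof.
have p0 : p%:Z != 0 by rewrite eqz_nat -lt0n prime_gt0.
elim: i => [|i IH] /=; first by rewrite expn0 mulr1.
by rewrite /phi_p expnSr PoszM mulrA dvdz_mull // mulzK // IH.
Qed.

Lemma iter_phi_p_ndvd i v n :
  ~~ ((p ^ i)%N%:Z %| n)%Z -> iter i (phi_p p phi) v n = 0.
Proof.
elim: i n => [|i IH] n /=; first by rewrite dvd1z.
rewrite /phi_p; case: ifPn => // /dvdzP[c ->] h.
have p0 : p%:Z != 0 by rewrite eqz_nat -lt0n prime_gt0.
rewrite mulzK // IH ?rmorph0 //; apply: contra h.
by rewrite expnSr PoszM => h; apply: dvdz_mul.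
Qed.

Lemma iter_delta_q j u n : iter j (@delta_q R) u n = n%:~R ^+ j * u n.
Proof.
elim: j => [|j IH] /=; first by rewrite mul1r.
by rewrite /delta_q IH mulrA -exprS.
Qed.

Lemma iter_frob_int i n : iter i phi n%:~R = n%:~R.
Proof. by elim: i => //= i ->; rewrite rmorph_int. Qed.

Lemma iter_frobX i j (x : R) : iter i phi (x ^+ j) = iter i phi x ^+ j.
Proof. by elim: i => //= i ->; rewrite rmorphXn. Qed.

Variable mu : {poly {poly R}}.

(** The [i]-th iterate of [phi_p] moves exponent [n] to [n * p ^ i], so only [i <= m] contributes;
    there [delta_q] acts as multiplication by [k * p ^ (m - i)], which becomes the argument of the
    inner polynomial. *)
Lemma psi_a_ppart u k m : ~~ (p %| k)%Z ->
  psi_a p phi mu u (k * (p ^ m)%N%:Z) =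
  \sum_(i < m.+1) (mu`_i).[(k * (p ^ (m - i))%N%:Z)%:~R] *
    iter i phi (u (k * (p ^ (m - i))%N%:Z)).
Proof.
move=> pk.
pose g i := if (i <= m)%N then (mu`_i).[(k * (p ^ (m - i))%N%:Z)%:~R] *
    iter i phi (u (k * (p ^ (m - i))%N%:Z)) else 0.
transitivity (\sum_(i < size mu) g i).
  apply: eq_bigr => i _; rewrite /g; case: leqP => [im|mi]; last first.
    rewrite big1 // => j _; rewrite iter_phi_p_ndvd ?mulr0 //.
    apply: contra pk => /dvdzP[c]; rewrite -(subnK (ltnW mi)) expnD PoszM mulrA.
    have q0 : (p ^ m)%N%:Z != 0 by rewrite eqz_nat -lt0n expn_gt0 prime_gt0.
    move/(mulIf q0) => ->; rewrite dvdz_mull // dvdzE dvdn_exp //.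
    by rewrite subn_gt0.
  rewrite horner_coef mulr_suml; apply: eq_bigr => j _.
  rewrite -{1}(subnK im) expnD PoszM mulrA iter_phi_p iter_delta_q.
  by rewrite iter_frobM iter_frobX iter_frob_int mulrA.
transitivity (\sum_(i < m.+1) g i); last first.
  by apply: eq_bigr => -[i im] _; rewrite /g /= -ltnS im.
(* A common range for the two sums: [g] vanishes beyond either bound. *)
pose M := maxn (size mu) m.+1.
rewrite (big_ord_widen M) ?leq_maxl // [RHS](big_ord_widen M) ?leq_maxr //.
rewrite big_mkcond [RHS]big_mkcond; apply: eq_bigr => i _ /=.
rewrite ltnS; case: (ltnP i (size mu)) => [_|mui].
  by rewrite /g; case: leqP.
by rewrite /g nth_default // horner0 mul0r; case: leqP.
Qed.

Lemma psi_a0 u : u 0 = 0 -> psi_a p phi mu u 0 = 0.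
Proof.
move=> u0; apply: big1 => i _; apply: big1 => j _.
rewrite -[0 as X in iter _ _ _ X](mul0r (p ^ i)%N%:Z) iter_phi_p.
by rewrite iter_delta_q u0 mulr0 iter_frob0 mulr0.
Qed.

End SeriesOperators.

(** * Solutions as sums of basic series *)

Section Solutions.
Variables (p : nat) (R : idomainType) (phi : {rmorphism R -> R}).
Variable mu : {poly {poly R}}.
Hypotheses (pp : prime p) (p2 : p <> 2%N) (HR : completed_max_unramified p R).
Hypotheses (Hphi : frobenius_lift p phi) (nd : nondegenerate_char mu).
Implicit Types (u v : int -> R) (k n : int) (s : bool).

Local Notation bc := (b p phi mu).
Local Notation bas := (basic p phi mu).
Local Notation K := (K_ mu).
Local Notation U := (U_ p phi mu).

(** The value is congruent modulo [p] to the unit [mu.[0].[0]]. *)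
Lemma unit_mu0 n : (p %| n)%Z -> (mu`_0).[n%:~R] \is a GRing.unit.
Proof.
move=> /dvdzP[c ->]; move: nd.
rewrite /nondegenerate_char (horner_coef0 mu) => u0.
apply: (unit_near HR u0).
rewrite horner_coef (horner_coef (mu`_0) 0) -sumrB.
apply: pdvd_sum => i _; rewrite -mulrBr; apply/pdvd_mull/pdvd_congX.
by rewrite subr0 rmorphM; apply/pdvd_mull/pdvd_p.
Qed.

Lemma char_int_prime k : char_int mu k -> ~~ (p %| k)%Z.
Proof.
rewrite /char_int /= (horner_coef0 mu) => k0; apply/negP => /unit_mu0.
by rewrite k0 unitr0.
Qed.

(** The terms with [i > 0] are the numerator in the recursion of [bc], up to sign, so the equation
    measures the failure of that recursion at the next step. *)
Lemma psi_a_rec u k m : ~~ (p %| k)%Z ->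
  (forall l, (l <= m)%N -> u (k * (p ^ l)%N%:Z) = bc k l * iter l phi (u k)) ->
  psi_a p phi mu u (k * (p ^ m.+1)%N%:Z) =
  (mu`_0).[(k * (p ^ m.+1)%N%:Z)%:~R] *
    (u (k * (p ^ m.+1)%N%:Z) - bc k m.+1 * iter m.+1 phi (u k)).
Proof.
move=> pk ul; have N0 : (mu`_0).[(k * (p ^ m.+1)%N%:Z)%:~R] \is a GRing.unit.
  by apply: unit_mu0; rewrite expnSr PoszM mulrA dvdz_mull.
rewrite psi_a_ppart // big_ord_recl /= subn0 mulrBr; congr (_ + _).
rewrite bES // !mulNr mulrN opprK mulrA (mulrC _.[_]) mulrVK //.
rewrite big_add1 big_mkord mulr_suml; apply: eq_bigr => i _.
rewrite /bump leq0n add1n add0n -!iterS subSS ul ?leq_subr // iter_frobM.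
rewrite -mulrA; congr (_ * (_ * _)).
by rewrite -iterD addSn subnKC // -ltnS.
Qed.

Lemma psi_a_eq0 s u : series s u ->
  psi_a p phi mu u = 0 <->
  forall k, ~~ (p %| k)%Z -> (mu`_0).[k%:~R] * u k = 0 /\
    forall m, u (k * (p ^ m)%N%:Z) = bc k m * iter m phi (u k).
Proof.
move=> us; have psi0 k : ~~ (p %| k)%Z ->
    psi_a p phi mu u (k * (p ^ 0)%N%:Z) = (mu`_0).[k%:~R] * u k.
  by move=> pk; rewrite psi_a_ppart // big_ord1 /= expn0 mulr1.
split=> [u0 k pk|h].
  split; first by rewrite -psi0 // u0.
  elim/ltn_ind => -[|m] IH; first by rewrite expn0 mulr1 mul1r.
  (* The factor [mu_0] is a unit at this multiple of [p], so the other factor vanishes. *)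
  have := psi_a_rec pk IH; rewrite u0 => /esym/eqP; rewrite mulf_eq0 subr_eq0.
  case/orP => [/eqP e|/eqP //].
  have := unit_mu0 (_ : p %| k * (p ^ m.+1)%N%:Z)%Z.
  by rewrite e unitr0 expnSr PoszM mulrA dvdz_mull // => /(_ isT).
apply/funext => n; have [->|/(int_ppart pp)[k [[|m] [pk ->]]]] := eqVneq n 0.
- by rewrite psi_a0 // us //; case: (s).
- by rewrite psi0 //; have [] := h k pk.
- have [_ hk] := h k pk; rewrite psi_a_rec // hk subrr mulr0.
  by [].
Qed.

Lemma series_ext s u v : series s u -> series s v ->
  (forall k m, ~~ (p %| k)%Z -> on_side s k ->
    u (k * (p ^ m)%N%:Z) = v (k * (p ^ m)%N%:Z)) -> u = v.
Proof.
move=> us vs h; apply/funext => n.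
have [ns|ns] := boolP (on_side s n); last by rewrite us ?vs.
have [n0|/(int_ppart pp)[k [m [pk nE]]]] := eqVneq n 0.
  by move: ns; rewrite n0; case: (s).
by rewrite nE h // -(on_side_ppart pp s k m) -nE.
Qed.

Lemma K_prime s k : k \in K s -> ~~ (p %| k)%Z.
Proof. by move/(mem_K_ s k pp HR nd) => [/char_int_prime]. Qed.

Lemma K_neq0 s k : k \in K s -> k != 0.
Proof. by move/K_prime; apply: contraNneq => ->; rewrite dvdz0. Qed.

(** The general solution, with [a] as initial coefficients; by [comb_U] and [U_comb] these series
    are exactly the elements of [U s]. *)
Definition comb s (a : int -> R) : int -> R := \sum_(k <- K s) bas k (a k).

(** Characteristic integers are prime to [p], so distinct basic series have disjoint supports. *)
Lemma comb_ppart s a k m : ~~ (p %| k)%Z ->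
  comb s a (k * (p ^ m)%N%:Z) =
  if k \in K s then bc k m * iter m phi (a k) else 0.
Proof.
move=> pk; rewrite /comb fct_sumE.
have b0 l : l \in K s -> l != k -> bas l (a l) (k * (p ^ m)%N%:Z) = 0.
  move=> lK lk; apply: basic0 => n; apply: contra lk => /eqP e.
  by have [-> _] := int_ppart_uniq pp pk (K_prime lK) e.
case: ifPn => kK.
  rewrite (bigD1_seq k) ?fset_uniq //= basicE ?prime_gt1 ?(K_neq0 kK) //.
  by rewrite big_seq_cond big1 ?addr0 // => l /andP[]; exact: b0.
rewrite big_seq big1 // => l lK; apply: b0 => //.
by apply: contraNneq kK => <-.
Qed.

Lemma comb_coef s a k : ~~ (p %| k)%Z ->
  comb s a k = if k \in K s then a k else 0.
Proof.
by move=> pk; rewrite -{1}[k]mulr1 -[1]/(p ^ 0)%N%:Z comb_ppart // mul1r.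
Qed.

Lemma comb_series s a : series s (comb s a).
Proof.
move=> n ns; rewrite /comb fct_sumE big_seq big1 // => k kK.
apply: basic0 => m; apply: contraNneq ns => ->; rewrite on_side_ppart //.
by have [] := (mem_K_ s k pp HR nd).1 kK.
Qed.

Lemma comb_U s a : U s (comb s a).
Proof.
split; first exact: comb_series.
apply/(psi_a_eq0 (@comb_series s a)) => k pk; rewrite comb_coef //; split.
  case: ifPn => kK; last by rewrite mulr0.
  have [] := (mem_K_ s k pp HR nd).1 kK.
  by rewrite /char_int /= (horner_coef0 mu) => ->; rewrite mul0r.
by move=> m; rewrite comb_ppart //; case: ifP => // _; rewrite iter_frob0 mulr0.
Qed.

(** At a [k] prime to [p] on the given side but outside [K s], the factor [mu_0] is nonzero and
    forces [u k = 0], which kills the whole class of [k]. *)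
Lemma U_comb s u : U s u -> u = comb s u.
Proof.
move=> [us u0]; apply: (series_ext us (@comb_series s u)) => k m pk ks.
have [uk ->] := (psi_a_eq0 us).1 u0 k pk.
rewrite comb_ppart //; case: ifPn => // kK.
suff -> : u k = 0 by rewrite iter_frob0 mulr0.
move/eqP: uk; rewrite mulf_eq0 => /orP[/eqP k0|/eqP //]; case/negP: kK.
apply/(mem_K_ s k pp HR nd); split=> //.
by rewrite /char_int /= (horner_coef0 mu).
Qed.

Lemma comb_eq s a c : (forall k, k \in K s -> a k = c k) -> comb s a = comb s c.
Proof. by move=> h; apply: eq_big_seq => k /h ->. Qed.

(** * The module structure on the solutions *)

Lemma basicD k (a c : R) : bas k (a + c) = bas k a + bas k c.
Proof.
apply/funext => n; rewrite /basic /= -[RHS]big_split.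
by apply: eq_bigr => m _ /=; rewrite iter_frobD mulrDr.
Qed.

Lemma combD s a c : comb s (fun k => a k + c k) = comb s a + comb s c.
Proof. by rewrite /comb -big_split; apply: eq_bigr => k _; apply: basicD. Qed.

(** A result exists by surjectivity of [ev_char]. It is unique because [conv_basic] sees [f k] only
    through its evaluation [x], and the parameters of [u] are its coefficients on [K s]. *)
Lemma star_comb s (x : R) u : U s u ->
  star p phi mu s x u = comb s (fun k => x * u k).
Proof.
move=> Uu; apply: xget_unique.
  have /choice[f Hf] : forall k, exists f : R -> R, k \in K s ->
      completed_group_ring p f /\ ev_char p k f = x.
    move=> k; have [kK|kK] := boolP (k \in K s); last by exists (fun=> 0).
    have [f Hf] := ev_char_surj pp HR Hphi x (K_neq0 kK).
    by exists f.
  exists u, f; split=> //; first exact: U_comb.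
  apply: eq_big_seq => k kK; have [fc <-] := Hf k kK.
  by rewrite (conv_basic pp p2 HR Hphi) // (K_neq0 kK).
move=> _ [a [f [Hf uE ->]]]; apply: eq_big_seq => k kK.
have [fc fx] := Hf k kK.
rewrite (conv_basic pp p2 HR Hphi) ?(K_neq0 kK) // fx; congr (bas k (x * _)).
by rewrite uE -/(comb s a) comb_coef ?(K_prime kK) // kK.
Qed.

Lemma comb_K s a k : k \in K s -> comb s a k = a k.
Proof. by move=> kK; rewrite comb_coef ?(K_prime kK) // kK. Qed.

Lemma star_coef s x u k : U s u -> k \in K s -> star p phi mu s x u k = x * u k.
Proof. by move=> Uu kK; rewrite star_comb // comb_K. Qed.

Lemma star_U s x u : U s u -> U s (star p phi mu s x u).
Proof. by move=> Uu; rewrite star_comb //; apply: comb_U. Qed.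

(** Reduces each module axiom to an identity in [R] between coefficients. *)
Lemma U_ext s u v : U s u -> U s v ->
  (forall k, k \in K s -> u k = v k) -> u = v.
Proof. by move=> /U_comb uE /U_comb vE h; rewrite uE vE; apply: comb_eq. Qed.

Lemma U_0 s : U s 0.
Proof.
suff <- : comb s (fun=> 0) = 0 by apply: comb_U.
by apply: (addrI (comb s (fun=> 0))); rewrite -combD !addr0.
Qed.

Lemma U_D s u v : U s u -> U s v -> U s (u + v).
Proof. by move=> /U_comb -> /U_comb ->; rewrite -combD; apply: comb_U. Qed.

Lemma U_N s u : U s u -> U s (- u).
Proof.
move=> Uu; have -> : - u = comb s (fun k => - u k); last exact: comb_U.
apply/eqP; rewrite eq_sym -addr_eq0 {2}(U_comb Uu) -combD.
rewrite (@comb_eq _ _ (fun=> 0)); last by move=> k _; rewrite addNr.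
apply/eqP/(U_ext (comb_U _ _) (U_0 s)) => k kK; exact: comb_K.
Qed.

Lemma U_B s u v : U s u -> U s v -> U s (u - v).
Proof. by move=> Uu Uv; apply: U_D => //; apply: U_N. Qed.

Lemma star_module s : module_on (U s) (star p phi mu s).
Proof.
split=> [|u v|x u|x y u Uu|u Uu|x u v Uu Uv|x y u Uu].
- exact: U_0.
- exact: U_B.
- exact: star_U.
- have Uy := star_U y Uu; apply: (U_ext (star_U _ Uy) (star_U _ Uu)) => k kK.
  by rewrite !star_coef // mulrA.
- by apply: (U_ext (star_U _ Uu) Uu) => k kK; rewrite star_coef // mul1r.
- have Uuv := U_D Uu Uv; have Uxuv := U_D (star_U x Uu) (star_U x Uv).
  apply: (U_ext (star_U _ Uuv) Uxuv) => k kK.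
  by rewrite star_coef // !addrfctE !star_coef // mulrDr.
- have Uxy := U_D (star_U x Uu) (star_U y Uu).
  apply: (U_ext (star_U _ Uu) Uxy) => k kK.
  by rewrite star_coef // addrfctE !star_coef // mulrDl.
Qed.

(** * The coordinate isomorphism and the expansion in basic series *)

Lemma nth_K s (i : 'I_(rho mu s)) : nth 0 (K s) i \in K s.
Proof. exact: mem_nth. Qed.

Lemma B0s_iso s : module_iso_on (U s) (star p phi mu s) (@B0s R mu s).
Proof.
split=> [u v Uu Uv|x u Uu|].
- by apply/rowP => i; rewrite !mxE.
- by apply/rowP => i; rewrite !mxE /B0 star_coef // nth_K.
split=> // [u v /set_mem Uu /set_mem Uv /rowP h|w _].
  apply: (U_ext Uu Uv) => k kK.
  have ik : (index k (K s) < rho mu s)%N by rewrite index_mem.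
  by have := h (Ordinal ik); rewrite !mxE /B0 /= nth_index.
(* The preimage of [w] has its coordinates as initial coefficients; the value 0 occurs only off
   [K s]. *)
pose a k := if insub (index k (K s)) is Some i then w 0 i else 0.
exists (comb s a); first exact: comb_U.
apply/rowP => i; rewrite mxE /B0 comb_K ?nth_K // /a index_uniq ?fset_uniq //.
by rewrite valK.
Qed.

Lemma basic_U s k x : k \in K s -> U s (bas k x).
Proof.
move=> kK; have -> : bas k x = comb s (fun l => if l == k then x else 0).
  rewrite /comb (bigD1_seq k) ?fset_uniq //= eqxx.
  rewrite big1 ?addr0 // => l /negbTE ->.
  apply/funext => n; apply: big1 => m _.
  by rewrite iter_frob0 mulr0.
exact: comb_U.
Qed.

Lemma star_basic s k x : k \in K s -> star p phi mu s x (bas k 1) = bas k x.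
Proof.
move=> kK; have U1 := basic_U 1 kK.
(* An element of [K s] is prime to [p], so it can lie in the support of the basic series only as
   [k * p ^ 0]. *)
have coef y l : l \in K s -> bas k y l = if l == k then y else 0.
  move=> lK; case: eqP => [->|lk].
    rewrite -{2}[k]mulr1 -[1]/(p ^ 0)%N%:Z.
    by rewrite basicE ?prime_gt1 ?(K_neq0 kK) ?mul1r.
  apply: basic0 => n; apply/eqP; rewrite -{1}[l]mulr1 -[1]/(p ^ 0)%N%:Z.
  by move/(int_ppart_uniq pp (K_prime lK) (K_prime kK)) => [].
apply: (U_ext (star_U _ U1) (basic_U _ kK)) => l lK.
by rewrite star_coef // !coef //; case: eqP => _; rewrite ?mulr1 ?mulr0.
Qed.

End Solutions.

Theorem corollary6p13 (p : nat) (R : idomainType) (phi : {rmorphism R -> R})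
    (mu : {poly {poly R}}) :
  prime p -> p <> 2%N ->
  completed_max_unramified p R ->
  frobenius_lift p phi ->
  nondegenerate_char mu ->
  forall s : bool,
    [/\ module_on (U_ p phi mu s) (star p phi mu s),
        module_iso_on (U_ p phi mu s) (star p phi mu s) (@B0s R mu s)
      & forall u, U_ p phi mu s u ->
          u = \sum_(k <- K_ mu s) star p phi mu s (B0 k u) (basic p phi mu k 1)].
Proof.
move=> pp p2 HR Hphi nd s; split.
- exact: star_module.
- exact: B0s_iso.
move=> u Uu; rewrite {1}(U_comb pp HR nd Uu).
by apply: eq_big_seq => k kK; rewrite star_basic.
Qed.
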